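(* Let $\mathcal{I}^L_1,\dots,\mathcal{I}^L_5$ be the left quaternionic Pauli matrices on $\mathbb{R}^8\cong\mathbb{H}^2$ (anti-commuting self-adjoint involutions), and for $1\le\alpha<\beta\le5$ let $\eta_{\alpha\beta}$ be the Kähler 2-form of the complex structure $J^L_{\alpha\beta}=\mathcal{I}^L_\alpha\circ\mathcal{I}^L_\beta$. Then the Cayley calibration $\Phi_{\mathrm{Spin}(7)}\in\Lambda^4\mathbb{R}^8$ is $$\Phi_{\mathrm{Spin}(7)}=\frac14\big[\eta_{12}^2+\eta_{13}^2+\eta_{24}^2+\eta_{34}^2-\eta_{23}^2-\eta_{14}^2-\eta_{15}^2-\eta_{25}^2-\eta_{35}^2-\eta_{45}^2\big],$$ and the right quaternion Kähler 4-form $\Omega_R$ is $$\Omega_R=-\frac12\big[\eta_{12}^2+\eta_{13}^2+\eta_{24}^2+\eta_{34}^2+\eta_{23}^2+\eta_{14}^2+\eta_{15}^2+\eta_{25}^2+\eta_{35}^2+\eta_{45}^2\big].$$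
   Context: Octonion multiplication is defined by Cayley–Dickson: for $x=h_1+h_2e$, $x'=h_1'+h_2'e$ with $h_1,h_2,h_1',h_2'\in\mathbb{H}$, $xx'=(h_1h_1'-\bar h_2'h_2)+(h_2\bar h_1'+h_2'h_1)e$. The standard basis of $\mathbb{O}$ is $1,i,j,k,e,f=ie,g=je,h=ke$, and $\mathbb{R}^8\cong\mathbb{H}^2\cong\mathbb{O}$ by $(h_1,h_2)\leftrightarrow h_1+h_2e$, with the standard inner product $\langle\cdot,\cdot\rangle$. For an orthogonal complex structure $J$ on $\mathbb{R}^8$, its Kähler 2-form is $\omega_J(x,y)=\langle x,Jy\rangle$. For a 2-form $\omega$, $\omega^2=\omega\wedge\omega$. Left quaternionic Pauli matrices: for $u\in\{i,j,k\}$ let $L_u:\mathbb{H}\to\mathbb{H}$, $L_u(q)=uq$. In $4+4$ block form on $\mathbb{H}\oplus\mathbb{H}$, $$\mathcal{I}^L_1=\begin{pmatrix}0&\mathrm{Id}\\ \mathrm{Id}&0\end{pmatrix},\ \mathcal{I}^L_2=\begin{pmatrix}0&-L_i\\ L_i&0\end{pmatrix},\ \mathcal{I}^L_3=\begin{pmatrix}0&-L_j\\ L_j&0\end{pmatrix},\ \mathcal{I}^L_4=\begin{pmatrix}0&-L_k\\ L_k&0\end{pmatrix},\ \mathcal{I}^L_5=\begin{pmatrix}\mathrm{Id}&0\\0&-\mathrm{Id}\end{pmatrix}.$$ The Cayley calibration is the 4-form $\Phi_{\mathrm{Spin}(7)}\in\Lambda^4\mathbb{R}^8$ with $\Phi_{\mathrm{Spin}(7)}(x,y,z,w)=\langle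 x,y(\bar zw)\rangle$ for orthogonal $y,z,w\in\mathbb{O}$; equivalently $\Phi_{\mathrm{Spin}(7)}=-\frac16(\phi_i^2+\phi_j^2+\phi_k^2+\phi_e^2+\phi_f^2+\phi_g^2+\phi_h^2)$, where $\phi_u$ is the Kähler 2-form of the octonionic right multiplication $R_u(x)=xu$ on $\mathbb{O}$. The right quaternion Kähler 4-form is $\Omega_R=\omega_{R_i}^2+\omega_{R_j}^2+\omega_{R_k}^2$, where $\omega_{R_u}$ ($u\in\{i,j,k\}$) is the Kähler 2-form of the quaternionic right multiplication $(h_1,h_2)\mapsto(h_1u,h_2u)$ on $\mathbb{H}^2$. *)

(* Defs.v *)
From HB Require Import structures.
From mathcomp Require Import all_boot all_order all_algebra all_fingroup.
From mathcomp Require Import reals.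
From mathcomp Require Import ring.

Set Implicit Arguments.
Unset Strict Implicit.
Unset Printing Implicit Defensive.

Import Order.TTheory GRing.Theory Num.Theory.
Local Open Scope ring_scope.

Section AlternatingForms.
Variables (R : realType) (V : lmodType R).

Definition tupdate k (v : k.-tuple V) (i : 'I_k) (x : V) : k.-tuple V :=
  [tuple if j == i then x else tnth v j | j < k].

Definition multilinear_form k (f : k.-tuple V -> R) : Prop :=
  forall (v : k.-tuple V) (i : 'I_k) (a : R) (x y : V),
    f (tupdate v i (a *: x + y)) = a * f (tupdate v i x) + f (tupdate v i y).

Definition alternating_form k (f : k.-tuple V -> R) : Prop :=
  multilinear_form f /\
  forall (v : k.-tuple V) (i j : 'I_k),
    i != j -> tnth v i = tnth v j -> f v = 0.

(* The normalisation is the one for which the wedge product of the 1-forms   *)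
(* a_1, ..., a_k is v |-> \det (a_i v_j); in particular (w /\ w)(x, y, z, t) *)
(* is 2 (w(x, y) w(z, t) - w(x, z) w(y, t) + w(x, t) w(y, z)).               *)
Definition wedge k l (f : k.-tuple V -> R) (g : l.-tuple V -> R)
    (v : (k + l).-tuple V) : R :=
  (k`! * l`!)%:R^-1 *
  \sum_(s : 'S_(k + l)) (-1) ^+ s *
     (f [tuple tnth v (s (lshift l i)) | i < k] *
      g [tuple tnth v (s (rshift k j)) | j < l]).

Definition wedge_sq (w : 2.-tuple V -> R) : 4.-tuple V -> R := wedge w w.

End AlternatingForms.

Definition dot (R : realType) n (x y : 'cV[R]_n) : R :=
  \sum_(i < n) x i 0 * y i 0.

Definition kahler (R : realType) n (J : 'cV[R]_n -> 'cV[R]_n)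
    (v : 2.-tuple 'cV[R]_n) : R :=
  dot (tnth v 0) (J (tnth v 1)).

Section CayleyDickson.
Variable R : realType.

(* quat a b c d is a + bi + cj + dk *)
Definition quat (a b c d : R) : 'cV[R]_4 := \col_(n < 4) [:: a; b; c; d]`_n.

Definition qcoef (p : 'cV[R]_4) (n : nat) : R := p (inord n) 0.

Definition qmul (p q : 'cV[R]_4) : 'cV[R]_4 :=
  let: (a, b, c, d) := (qcoef p 0, qcoef p 1, qcoef p 2, qcoef p 3) in
  let: (a', b', c', d') := (qcoef q 0, qcoef q 1, qcoef q 2, qcoef q 3) in
  quat (a * a' - b * b' - c * c' - d * d')
       (a * b' + b * a' + c * d' - d * c')
       (a * c' - b * d' + c * a' + d * b')
       (a * d' + b * c' - c * b' + d * a').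

Definition qconj (p : 'cV[R]_4) : 'cV[R]_4 :=
  quat (qcoef p 0) (- qcoef p 1) (- qcoef p 2) (- qcoef p 3).

Definition quat_i : 'cV[R]_4 := quat 0 1 0 0.
Definition quat_j : 'cV[R]_4 := quat 0 0 1 0.
Definition quat_k : 'cV[R]_4 := quat 0 0 0 1.

(* The pair (h1, h2) of H^2, identified with the octonion h1 + h2 e. *)
Definition Hpair (h1 h2 : 'cV[R]_4) : 'cV[R]_8 :=
  col_mx h1 h2 : 'cV[R]_(4 + 4).
Definition Hfst (x : 'cV[R]_8) : 'cV[R]_4 := usubmx (x : 'cV[R]_(4 + 4)).
Definition Hsnd (x : 'cV[R]_8) : 'cV[R]_4 := dsubmx (x : 'cV[R]_(4 + 4)).

Definition omul (x y : 'cV[R]_8) : 'cV[R]_8 :=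
  Hpair (qmul (Hfst x) (Hfst y) - qmul (qconj (Hsnd y)) (Hsnd x))
        (qmul (Hsnd x) (qconj (Hfst y)) + qmul (Hsnd y) (Hfst x)).

Definition oconj (x : 'cV[R]_8) : 'cV[R]_8 :=
  Hpair (qconj (Hfst x)) (- Hsnd x).

Definition oct_i : 'cV[R]_8 := Hpair quat_i 0.
Definition oct_j : 'cV[R]_8 := Hpair quat_j 0.
Definition oct_k : 'cV[R]_8 := Hpair quat_k 0.
Definition oct_e : 'cV[R]_8 := Hpair 0 (quat 1 0 0 0).
Definition oct_f : 'cV[R]_8 := omul oct_i oct_e.
Definition oct_g : 'cV[R]_8 := omul oct_j oct_e.
Definition oct_h : 'cV[R]_8 := omul oct_k oct_e.

Definition right_omul (u x : 'cV[R]_8) : 'cV[R]_8 := omul x u.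

Definition right_qmul (u : 'cV[R]_4) (x : 'cV[R]_8) : 'cV[R]_8 :=
  Hpair (qmul (Hfst x) u) (qmul (Hsnd x) u).

End CayleyDickson.

Section Pauli.
Variable R : realType.

(* matrix of q |-> uq *)
Definition left_qmul_mx (u : 'cV[R]_4) : 'M[R]_4 :=
  \matrix_(i, j) qmul u (delta_mx j 0) i 0.

(* indices run from 1 to 5; the value at any other index is irrelevant *)
Definition pauli (a : nat) : 'M[R]_8 :=
  let twist u : 'M[R]_(4 + 4) :=
    block_mx 0 (- left_qmul_mx u) (left_qmul_mx u) 0 in
  match a with
  | 1 => block_mx 0 1%:M 1%:M 0 : 'M[R]_(4 + 4)
  | 2 => twist (quat_i R)
  | 3 => twist (quat_j R)
  | 4 => twist (quat_k R)
  | 5 => block_mx 1%:M 0 0 (- 1%:M) : 'M[R]_(4 + 4)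
  | _ => 0
  end.

Definition pauliJ (a b : nat) (x : 'cV[R]_8) : 'cV[R]_8 :=
  pauli a *m (pauli b *m x).

Definition eta (a b : nat) : 2.-tuple 'cV[R]_8 -> R := kahler (pauliJ a b).

Definition eta_sq (a b : nat) : 4.-tuple 'cV[R]_8 -> R := wedge_sq (eta a b).

End Pauli.

Arguments pauli R a : clear implicits.
Arguments pauliJ R a b x : clear implicits.
Arguments eta R a b v : clear implicits.
Arguments eta_sq R a b v : clear implicits.

Section Calibrations.
Variable R : realType.

(* These conditions determine Phi; a 4-form satisfying them is exhibited in  *)
(* cayley_calibration_sum below.                                             *)
Definition cayley_calibration (Phi : 4.-tuple 'cV[R]_8 -> R) : Prop :=
  alternating_form Phi /\
  forall x y z w : 'cV[R]_8,
    dot y z = 0 -> dot y w = 0 -> dot z w = 0 ->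
    Phi [tuple x; y; z; w] = dot x (omul y (omul (oconj z) w)).

Definition phi (u : 'cV[R]_8) : 2.-tuple 'cV[R]_8 -> R :=
  kahler (right_omul u).

Definition OmegaR (v : 4.-tuple 'cV[R]_8) : R :=
  wedge_sq (kahler (right_qmul (quat_i R))) v
  + wedge_sq (kahler (right_qmul (quat_j R))) v
  + wedge_sq (kahler (right_qmul (quat_k R))) v.

End Calibrations.

Arguments OmegaR R v : clear implicits.

(* The rest of the file checks that the definitions are the intended ones:   *)
(* the Pauli matrices are anti-commuting self-adjoint involutions, and the   *)
(* Cayley calibration exists, being -1/6 the sum of the squares of the seven *)
(* forms phi_u.                                                              *)
Section SanityChecks.
Variable R : realType.

Lemma sum_Sn (n : nat) (F : 'S_n.+1 -> R) :
  \sum_(s : 'S_n.+1) F s =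
  \sum_(i < n.+1) \sum_(t : 'S_n) F (lift_perm ord0 i t).
Proof.
rewrite (partition_big (fun s : 'S_n.+1 => s ord0) predT) //=.
apply: eq_bigr => i _; rewrite (reindex (lift_perm ord0 i)) /=.
  by apply: eq_bigl => t; rewrite lift_perm_id eqxx.
pose ulsf i (s : 'S_n.+1) k := odflt k (unlift (s i) (s (lift i k))).
have ulsfK j (s : 'S_n.+1) k : lift (s j) (ulsf j s k) = s (lift j k).
  rewrite /ulsf; have:= neq_lift j k.
  by rewrite -(can_eq (permK s)) => /unlift_some[] ? ? ->.
have inj_ulsf : injective (ulsf ord0 _).
  move=> s; apply: can_inj (ulsf (s ord0) s^-1%g) _ => k'.
  by rewrite {1}/ulsf ulsfK !permK liftK.
exists (fun s => perm (inj_ulsf s)) => [s _ | s].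
  by apply/permP=> k'; rewrite permE /ulsf lift_perm_lift lift_perm_id liftK.
move/(s ord0 =P _) => si; apply/permP=> k.
case: (unliftP ord0 k) => [k'|] ->; rewrite ?lift_perm_id //.
by rewrite lift_perm_lift permE -si ulsfK.
Qed.

Lemma sum_S0 (F : 'S_0 -> R) : \sum_(s : 'S_0) F s = F 1%g.
Proof.
rewrite (eq_bigl (pred1 1%g)) ?big_pred1_eq // => s /=.
by apply/esym/eqP/permP => -[].
Qed.


Lemma sum_S4 (G : bool -> nat -> nat -> nat -> nat -> R) :
  \sum_(s : 'S_4) G s (s 0) (s 1) (s (inord 2)) (s (inord 3)) =
  \sum_(i < 4) \sum_(j < 3) \sum_(k < 2) \sum_(l < 1)
    G (odd (i + (j + (k + l)))) i (bump i j) (bump i (bump j k))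
      (bump i (bump j (bump k l))).
Proof.
have -> : 1 = lift ord0 ord0 :> 'I_4 by apply: val_inj.
have -> : inord 2 = lift ord0 (lift ord0 ord0) :> 'I_4.
  by apply: val_inj; rewrite /= inordK.
have -> : inord 3 = lift ord0 (lift ord0 (lift ord0 ord0)) :> 'I_4.
  by apply: val_inj; rewrite /= inordK.
have -> : 0 = ord0 :> 'I_4 by apply: val_inj.
rewrite sum_Sn; apply: eq_bigr => i _; rewrite sum_Sn; apply: eq_bigr => j _.
rewrite sum_Sn; apply: eq_bigr => k _; rewrite sum_Sn; apply: eq_bigr => l _.
rewrite sum_S0 !(lift_perm_id, lift_perm_lift) !odd_lift_perm odd_perm1.
by rewrite !oddD !addbF.
Qed.

Lemma wedge_sqE (V : lmodType R) (w : 2.-tuple V -> R) (x y z t : V) :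
  (forall a b, w [tuple b; a] = - w [tuple a; b]) ->
  wedge_sq w [tuple x; y; z; t] =
  2%:R * (w [tuple x; y] * w [tuple z; t] - w [tuple x; z] * w [tuple y; t]
          + w [tuple x; t] * w [tuple y; z]).
Proof.
move=> wC; rewrite /wedge_sq /wedge.
have mk2 (f : 'I_2 -> V) : [tuple f i | i < 2] = [tuple f 0; f 1].
  apply: eq_from_tnth => i; rewrite tnth_mktuple.
  by case: i => [[|[|i]]] lti //; rewrite (tnth_nth x) /=; congr f; apply: val_inj.
under eq_bigr do rewrite !mk2 !(tnth_nth x) /=.
have -> : lshift 2 (0 : 'I_2) = 0 :> 'I_4 by apply: val_inj.
have -> : lshift 2 (1 : 'I_2) = 1 :> 'I_4 by apply: val_inj.
have -> : rshift 2 (0 : 'I_2) = inord 2 :> 'I_4.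
  by apply: val_inj; rewrite /= inordK.
have -> : rshift 2 (1 : 'I_2) = inord 3 :> 'I_4.
  by apply: val_inj; rewrite /= inordK.
pose v n := nth x [:: x; y; z; t] n.
rewrite (sum_S4 (fun b i j k l =>
  (-1) ^+ b * (w [tuple v i; v j] * w [tuple v k; v l]))).
have -> : (2`! * 2`!)%:R = 4%:R :> R by [].
rewrite !(big_ord_recl, big_ord0) /= /v /= !expr0 !expr1.
rewrite (wC x y) (wC x z) (wC x t) (wC y z) (wC y t) (wC z t).
by field.
Qed.

Lemma tuple4P (V : Type) (v : 4.-tuple V) :
  exists x y z t, v = [tuple x; y; z; t].
Proof.
case: v => -[|x [|y [|z [|t [|? ?]]]]] // sz.
by exists x, y, z, t; apply: val_inj.
Qed.

Lemma wedge_sq_alternating (V : lmodType R) (w : 2.-tuple V -> R) :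
  (forall a b, w [tuple b; a] = - w [tuple a; b]) ->
  (forall c a b d, w [tuple a; c *: b + d] = c * w [tuple a; b] + w [tuple a; d]) ->
  alternating_form (wedge_sq w).
Proof.
move=> wC wD.
have wD' c a b d : w [tuple c *: b + d; a] = c * w [tuple b; a] + w [tuple d; a].
  by rewrite wC wD (wC b) (wC d); ring.
have w0 a : w [tuple a; a] = 0.
  apply/eqP; have /eqP := wC a a; rewrite -addr_eq0 -mulr2n mulrn_eq0.
  by rewrite /=.
split=> [v i c p q | v i j].
  have [x [y [z [t ->]]]] := tuple4P v.
  have upd p' : tupdate [tuple x; y; z; t] i p' =
    [tuple if i == 0%N :> nat then p' else x; if i == 1%N :> nat then p' else y;
           if i == 2%N :> nat then p' else z; if i == 3%N :> nat then p' else t].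
    apply: eq_from_tnth => j; rewrite tnth_mktuple !(tnth_nth x) /=.
    by case: i j => [[|[|[|[|?]]]] ?] // [[|[|[|[|?]]]] ?].
  by rewrite !upd; case: i {upd} => [[|[|[|[|?]]]] ?] //=;
    rewrite !wedge_sqE // ?wD ?wD'; ring.
have [x [y [z [t ->]]]] := tuple4P v; rewrite !(tnth_nth x).
by case: i j => [[|[|[|[|?]]]] ?] // [[|[|[|[|?]]]] ?] //= _ E;
  rewrite wedge_sqE // E ?w0 ?(wC x y) ?(wC x z) ?(wC x t) ?(wC y z) ?(wC y t)
    ?(wC z t); ring.
Qed.

Lemma quatP (p : 'cV[R]_4) : exists a b c d, p = quat a b c d.
Proof.
exists (p (inord 0) 0), (p (inord 1) 0), (p (inord 2) 0), (p (inord 3) 0).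
apply/colP => i; rewrite mxE.
by case: i => [[|[|[|[|?]]]] ?] //=; congr (p _ _); apply: val_inj;
  rewrite /= inordK.
Qed.

Lemma HpairP (x : 'cV[R]_8) : exists h g, x = Hpair h g.
Proof. by exists (Hfst x), (Hsnd x); rewrite /Hpair /Hfst vsubmxK. Qed.

Lemma HfstE (h g : 'cV[R]_4) : Hfst (Hpair h g) = h.
Proof. exact: col_mxKu. Qed.

Lemma HsndE (h g : 'cV[R]_4) : Hsnd (Hpair h g) = g.
Proof. exact: col_mxKd. Qed.

Lemma qcoefE (a b c d : R) :
  [/\ qcoef (quat a b c d) 0 = a, qcoef (quat a b c d) 1 = b,
       qcoef (quat a b c d) 2 = c & qcoef (quat a b c d) 3 = d].
Proof. by split; rewrite /qcoef mxE inordK. Qed.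

Lemma qmulE (a b c d a' b' c' d' : R) :
  qmul (quat a b c d) (quat a' b' c' d') =
  quat (a * a' - b * b' - c * c' - d * d')
       (a * b' + b * a' + c * d' - d * c')
       (a * c' - b * d' + c * a' + d * b')
       (a * d' + b * c' - c * b' + d * a').
Proof.
rewrite /qmul; have [-> -> -> ->] := qcoefE a b c d.
by have [-> -> -> ->] := qcoefE a' b' c' d'.
Qed.

Lemma qconjE (a b c d : R) : qconj (quat a b c d) = quat a (- b) (- c) (- d).
Proof. by rewrite /qconj; have [-> -> -> ->] := qcoefE a b c d. Qed.

Lemma quatD (a b c d a' b' c' d' : R) :
  quat a b c d + quat a' b' c' d' = quat (a + a') (b + b') (c + c') (d + d').
Proof.
by apply/colP => i; rewrite !mxE; case: i => [[|[|[|[|?]]]] ?].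
Qed.

Lemma quatN (a b c d : R) : - quat a b c d = quat (- a) (- b) (- c) (- d).
Proof. by apply/colP => i; rewrite !mxE; case: i => [[|[|[|[|?]]]] ?]. Qed.

Lemma quatZ (k a b c d : R) :
  k *: quat a b c d = quat (k * a) (k * b) (k * c) (k * d).
Proof. by apply/colP => i; rewrite !mxE; case: i => [[|[|[|[|?]]]] ?]. Qed.

Lemma quat0 : 0 = quat 0 0 0 0 :> 'cV[R]_4.
Proof. by apply/colP => i; rewrite !mxE; case: i => [[|[|[|[|?]]]] ?]. Qed.

Lemma HpairD (h g h' g' : 'cV[R]_4) :
  Hpair h g + Hpair h' g' = Hpair (h + h') (g + g').
Proof. by rewrite /Hpair; exact: (@add_col_mx _ 4 4 1). Qed.

Lemma HpairZ (k : R) (h g : 'cV[R]_4) : k *: Hpair h g = Hpair (k *: h) (k *: g).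
Proof. by rewrite /Hpair; exact: (@scale_col_mx _ 4 4 1). Qed.

Lemma dot_quat (a b c d a' b' c' d' : R) :
  dot (quat a b c d) (quat a' b' c' d') = a * a' + b * b' + c * c' + d * d'.
Proof.
by rewrite /dot !big_ord_recl big_ord0 !mxE /=; ring.
Qed.

Lemma dot_Hpair (h g h' g' : 'cV[R]_4) :
  dot (Hpair h g) (Hpair h' g') = dot h h' + dot g g'.
Proof.
rewrite /dot (@big_split_ord _ _ _ 4 4) /=.
by congr (_ + _); apply: eq_bigr => i _; congr (_ * _);
  first [exact: (@col_mxEu _ 4 4 1) | exact: (@col_mxEd _ 4 4 1)].
Qed.

Lemma omulE (h g h' g' : 'cV[R]_4) :
  omul (Hpair h g) (Hpair h' g') =
  Hpair (qmul h h' - qmul (qconj g') g) (qmul g (qconj h') + qmul g' h).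
Proof. by rewrite /omul !HfstE !HsndE. Qed.

Lemma oconjE (h g : 'cV[R]_4) : oconj (Hpair h g) = Hpair (qconj h) (- g).
Proof. by rewrite /oconj HfstE HsndE. Qed.

Definition octE :=
  (omulE, oconjE, qmulE, qconjE, HpairD, HpairZ, quatD, quatN, quatZ,
   dot_Hpair, dot_quat).

Lemma phiE (u x y : 'cV[R]_8) : phi u [tuple x; y] = dot x (omul y u).
Proof. by []. Qed.

Lemma octP (x : 'cV[R]_8) : exists a b c d a' b' c' d',
  x = Hpair (quat a b c d) (quat a' b' c' d').
Proof.
have [h [g ->]] := HpairP x.
have [a [b [c [d ->]]]] := quatP h; have [a' [b' [c' [d' ->]]]] := quatP g.
by exists a, b, c, d, a', b', c', d'.
Qed.

Lemma phi_skew (b c d a' b' c' d' : R) (x y : 'cV[R]_8) :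
  phi (Hpair (quat 0 b c d) (quat a' b' c' d')) [tuple y; x] =
  - phi (Hpair (quat 0 b c d) (quat a' b' c' d')) [tuple x; y].
Proof.
rewrite !phiE.
have [x0 [x1 [x2 [x3 [x4 [x5 [x6 [x7 ->]]]]]]]] := octP x.
have [y0 [y1 [y2 [y3 [y4 [y5 [y6 [y7 ->]]]]]]]] := octP y.
by rewrite !octE; ring.
Qed.

Lemma phi_alternating (b c d a' b' c' d' : R) :
  alternating_form
    (wedge_sq (phi (Hpair (quat 0 b c d) (quat a' b' c' d')))).
Proof.
apply: wedge_sq_alternating => [x y | k x y z]; first exact: phi_skew.
rewrite !phiE.
have [x0 [x1 [x2 [x3 [x4 [x5 [x6 [x7 ->]]]]]]]] := octP x.
have [y0 [y1 [y2 [y3 [y4 [y5 [y6 [y7 ->]]]]]]]] := octP y.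
have [z0 [z1 [z2 [z3 [z4 [z5 [z6 [z7 ->]]]]]]]] := octP z.
by rewrite !(HpairD, HpairZ, quatD, quatZ) !octE; ring.
Qed.

Lemma left_qmul_mxE (u : 'cV[R]_4) (a b c d : R) :
  left_qmul_mx u *m quat a b c d = qmul u (quat a b c d).
Proof.
have [u0 [u1 [u2 [u3 ->]]]] := quatP u; rewrite qmulE.
have dE (j : 'I_4) : delta_mx j 0 = quat (j == 0%N :> nat)%:R
    (j == 1%N :> nat)%:R (j == 2%N :> nat)%:R (j == 3%N :> nat)%:R :> 'cV[R]_4.
  apply/colP => i; rewrite !mxE eqxx andbT.
  by case: i j => [[|[|[|[|?]]]] ?] // [[|[|[|[|?]]]] ?].
have L (i j : 'I_4) : left_qmul_mx (quat u0 u1 u2 u3) i j =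
    qmul (quat u0 u1 u2 u3) (delta_mx j 0) i 0.
  by rewrite /left_qmul_mx mxE.
apply/colP => i; rewrite mxE !big_ord_recl big_ord0 !L !dE !qmulE !mxE /=.
by case: i => [[|[|[|[|?]]]] ?] //=; ring.
Qed.

Lemma pauliE (h g : 'cV[R]_4) :
  (pauli R 1 *m Hpair h g = Hpair g h) *
  (pauli R 2 *m Hpair h g = Hpair (- qmul (quat_i R) g) (qmul (quat_i R) h)) *
  (pauli R 3 *m Hpair h g = Hpair (- qmul (quat_j R) g) (qmul (quat_j R) h)) *
  (pauli R 4 *m Hpair h g = Hpair (- qmul (quat_k R) g) (qmul (quat_k R) h)) *
  (pauli R 5 *m Hpair h g = Hpair h (- g)).
Proof.
have LE (u q : 'cV[R]_4) : left_qmul_mx u *m q = qmul u q.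
  by have [a [b [c [d ->]]]] := quatP q; rewrite left_qmul_mxE.
have blk (A B C D : 'M[R]_4) :
    (block_mx A B C D : 'M[R]_8) *m Hpair h g =
    Hpair (A *m h + B *m g) (C *m h + D *m g).
  exact: (@mul_block_col _ 4 4 4 4 1).
by do !split; rewrite /= blk ?mulNmx ?mul1mx ?mul0mx ?LE ?addr0 ?add0r.
Qed.

Lemma HpairN (h g : 'cV[R]_4) : - Hpair h g = Hpair (- h) (- g).
Proof. by rewrite /Hpair; exact: (@opp_col_mx _ 4 4 1). Qed.

Lemma eq_oct (a b c d e f g h a' b' c' d' e' f' g' h' : R) :
  a = a' -> b = b' -> c = c' -> d = d' -> e = e' -> f = f' -> g = g' ->
  h = h' ->
  Hpair (quat a b c d) (quat e f g h) = Hpair (quat a' b' c' d') (quat e' f' g' h').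
Proof. by do 8 move->. Qed.

Lemma pauli_involution (a : nat) (x : 'cV[R]_8) :
  (1 <= a <= 5)%N -> pauli R a *m (pauli R a *m x) = x.
Proof.
have [x0 [x1 [x2 [x3 [x4 [x5 [x6 [x7 ->]]]]]]]] := octP x.
by case: a => [|[|[|[|[|[|a]]]]]] //= _;
  rewrite !pauliE /quat_i /quat_j /quat_k ?(qmulE, quatN);
  apply: eq_oct; ring.
Qed.

Lemma pauli_selfadjoint (a : nat) (x y : 'cV[R]_8) :
  (1 <= a <= 5)%N -> dot (pauli R a *m x) y = dot x (pauli R a *m y).
Proof.
have [x0 [x1 [x2 [x3 [x4 [x5 [x6 [x7 ->]]]]]]]] := octP x.
have [y0 [y1 [y2 [y3 [y4 [y5 [y6 [y7 ->]]]]]]]] := octP y.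
by case: a => [|[|[|[|[|[|a]]]]]] //= _;
  rewrite !pauliE /quat_i /quat_j /quat_k ?(qmulE, quatN) !dot_Hpair !dot_quat;
  ring.
Qed.

Lemma pauli_anticommute (a b : nat) (x : 'cV[R]_8) :
  (1 <= a <= 5)%N -> (1 <= b <= 5)%N -> a != b ->
  pauli R a *m (pauli R b *m x) = - (pauli R b *m (pauli R a *m x)).
Proof.
have [x0 [x1 [x2 [x3 [x4 [x5 [x6 [x7 ->]]]]]]]] := octP x.
by case: a b => [|[|[|[|[|[|a]]]]]] // [|[|[|[|[|[|b]]]]]] //= _ _ _;
  rewrite !pauliE /quat_i /quat_j /quat_k ?(qmulE, quatN) HpairN !quatN;
  apply: eq_oct; ring.
Qed.

Lemma alternatingD k (V : lmodType R) (f g : k.-tuple V -> R) :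
  alternating_form f -> alternating_form g ->
  alternating_form (fun v => f v + g v).
Proof.
move=> [fm fa] [gm ga]; split=> [v i a x y | v i j ij E].
  by rewrite fm gm; ring.
by rewrite (fa v i j) // (ga v i j) // addr0.
Qed.

Lemma alternatingZ k (V : lmodType R) (c : R) (f : k.-tuple V -> R) :
  alternating_form f -> alternating_form (fun v => c * f v).
Proof.
move=> [fm fa]; split=> [v i a x y | v i j ij E]; first by rewrite fm; ring.
by rewrite (fa v i j) // mulr0.
Qed.

Lemma oct_basisE :
  (oct_e R = Hpair (quat 0 0 0 0) (quat 1 0 0 0)) *
  (oct_f R = Hpair (quat 0 0 0 0) (quat 0 1 0 0)) *
  (oct_g R = Hpair (quat 0 0 0 0) (quat 0 0 1 0)) *
  (oct_h R = Hpair (quat 0 0 0 0) (quat 0 0 0 1)) *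
  (oct_i R = Hpair (quat 0 1 0 0) (quat 0 0 0 0)) *
  (oct_j R = Hpair (quat 0 0 1 0) (quat 0 0 0 0)) *
  (oct_k R = Hpair (quat 0 0 0 1) (quat 0 0 0 0)).
Proof.
by do !split;
  rewrite /oct_f /oct_g /oct_h /oct_i /oct_j /oct_k /oct_e /quat_i /quat_j
    /quat_k !quat0 ?octE; try apply: eq_oct; try ring.
Qed.

Lemma omul_basisE (a b c d e f g h : R) :
  let x := Hpair (quat a b c d) (quat e f g h) in
  (omul x (oct_i R) = Hpair (quat (- b) a d (- c)) (quat f (- e) (- h) g)) *
  (omul x (oct_j R) = Hpair (quat (- c) (- d) a b) (quat g h (- e) (- f))) *
  (omul x (oct_k R) = Hpair (quat (- d) c (- b) a) (quat h (- g) f (- e))) *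
  (omul x (oct_e R) = Hpair (quat (- e) (- f) (- g) (- h)) (quat a b c d)) *
  (omul x (oct_f R) = Hpair (quat (- f) e (- h) g) (quat (- b) a (- d) c)) *
  (omul x (oct_g R) = Hpair (quat (- g) h e (- f)) (quat (- c) d a (- b))) *
  (omul x (oct_h R) = Hpair (quat (- h) (- g) f e) (quat (- d) (- c) b a)).
Proof.
move=> x; rewrite !oct_basisE /x.
by do !split; rewrite !octE; apply: eq_oct; ring.
Qed.

Definition phi_vec (u y z w : 'cV[R]_8) : 'cV[R]_8 :=
  dot z (omul w u) *: omul y u - dot y (omul w u) *: omul z u
  + dot y (omul z u) *: omul w u.

Lemma phi_sum_vec (y z w : 'cV[R]_8) :
  - 3%:R^-1 *: (phi_vec (oct_i R) y z w + phi_vec (oct_j R) y z w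
    + phi_vec (oct_k R) y z w + phi_vec (oct_e R) y z w
    + phi_vec (oct_f R) y z w + phi_vec (oct_g R) y z w
    + phi_vec (oct_h R) y z w) =
  omul y (omul (oconj z) w) - dot y z *: w - dot z w *: y + dot y w *: z.
Proof.
rewrite /phi_vec.
have [y0 [y1 [y2 [y3 [y4 [y5 [y6 [y7 ->]]]]]]]] := octP y.
have [z0 [z1 [z2 [z3 [z4 [z5 [z6 [z7 ->]]]]]]]] := octP z.
have [w0 [w1 [w2 [w3 [w4 [w5 [w6 [w7 ->]]]]]]]] := octP w.
rewrite !omul_basisE !(oconjE, qconjE, quatN) !dot_Hpair !dot_quat.
rewrite !omulE !(qmulE, qconjE, quatN, quatD).
rewrite !(HpairZ, HpairN, quatZ, quatN, HpairD, quatD).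
apply: eq_oct; by field.
Qed.

Lemma dotD (x y z : 'cV[R]_8) : dot x (y + z) = dot x y + dot x z.
Proof. by rewrite -big_split; apply: eq_bigr => i _; rewrite mxE mulrDr. Qed.

Lemma dotZ (a : R) (x y : 'cV[R]_8) : dot x (a *: y) = a * dot x y.
Proof. by rewrite mulr_sumr; apply: eq_bigr => i _; rewrite mxE mulrCA. Qed.

Lemma dotN (x y : 'cV[R]_8) : dot x (- y) = - dot x y.
Proof. by rewrite -sumrN; apply: eq_bigr => i _; rewrite mxE mulrN. Qed.

Lemma phi_sqE (b c d a' b' c' d' : R) (x y z w : 'cV[R]_8) :
  let u := Hpair (quat 0 b c d) (quat a' b' c' d') in
  wedge_sq (phi u) [tuple x; y; z; w] = 2%:R * dot x (phi_vec u y z w).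
Proof.
move=> u; rewrite wedge_sqE; last by move=> p q; exact: phi_skew.
rewrite !phiE /phi_vec !(dotD, dotN, dotZ).
move: (dot x (omul y u)) (dot z (omul w u)) (dot x (omul z u))
  (dot y (omul w u)) (dot x (omul w u)) (dot y (omul z u)) => *; ring.
Qed.

Lemma phi_sumE (x y z w : 'cV[R]_8) :
  - 6%:R^-1 *
    (wedge_sq (phi (oct_i R)) [tuple x; y; z; w]
     + wedge_sq (phi (oct_j R)) [tuple x; y; z; w]
     + wedge_sq (phi (oct_k R)) [tuple x; y; z; w]
     + wedge_sq (phi (oct_e R)) [tuple x; y; z; w]
     + wedge_sq (phi (oct_f R)) [tuple x; y; z; w]
     + wedge_sq (phi (oct_g R)) [tuple x; y; z; w]
     + wedge_sq (phi (oct_h R)) [tuple x; y; z; w]) =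
  dot x (omul y (omul (oconj z) w)) - dot y z * dot x w - dot z w * dot x y
  + dot y w * dot x z.
Proof.
have := congr1 (dot x) (phi_sum_vec y z w).
rewrite dotZ 6!dotD dotD (dotD x _ (- (dot z w *: y))) dotD !dotN !dotZ.
rewrite !oct_basisE !phi_sqE.
move: (dot x (phi_vec (Hpair (quat 0 1 0 0) (quat 0 0 0 0)) y z w)) => a1.
move: (dot x (phi_vec (Hpair (quat 0 0 1 0) (quat 0 0 0 0)) y z w)) => a2.
move: (dot x (phi_vec (Hpair (quat 0 0 0 1) (quat 0 0 0 0)) y z w)) => a3.
move: (dot x (phi_vec (Hpair (quat 0 0 0 0) (quat 1 0 0 0)) y z w)) => a4.
move: (dot x (phi_vec (Hpair (quat 0 0 0 0) (quat 0 1 0 0)) y z w)) => a5.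
move: (dot x (phi_vec (Hpair (quat 0 0 0 0) (quat 0 0 1 0)) y z w)) => a6.
move: (dot x (phi_vec (Hpair (quat 0 0 0 0) (quat 0 0 0 1)) y z w)) => a7.
by move=> <-; field.
Qed.

Lemma cayley_calibration_sum :
  cayley_calibration (fun v => - 6%:R^-1 *
    (wedge_sq (phi (oct_i R)) v + wedge_sq (phi (oct_j R)) v
     + wedge_sq (phi (oct_k R)) v + wedge_sq (phi (oct_e R)) v
     + wedge_sq (phi (oct_f R)) v + wedge_sq (phi (oct_g R)) v
     + wedge_sq (phi (oct_h R)) v)).
Proof.
split; last first.
  by move=> x y z w yz yw zw; rewrite phi_sumE yz yw zw; ring.
rewrite !oct_basisE.
by apply: alternatingZ; do 6 (apply: alternatingD; last exact: phi_alternating);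
  exact: phi_alternating.
Qed.

End SanityChecks.

(* Main.v *)
Require Import Defs.
From mathcomp Require Import all_boot all_order all_algebra.
From mathcomp Require Import reals.
From mathcomp Require Import ring.
Import GRing.Theory Num.Theory.
Local Open Scope ring_scope.

(** The ten complex structures [pauliJ a b] span the Lie algebra sp(2) = so(5)
of endomorphisms of H^2 commuting with the right multiplications by i, j, k,
which span the complementary sp(1).  The sum of the squares of the ten forms
[eta a b] and the form [OmegaR] are both invariant under Sp(2)Sp(1), and such
4-forms make up a line; this is why they are proportional.

For the Cayley form, adding the two formulas to be proved shows that, given the
second, the first one says
  Phi = (eta_12^2 + eta_13^2 + eta_24^2 + eta_34^2 + OmegaR) / 2.
The four squares have a simple meaning.  Up to sign, J_12, J_34 are
diag(L_i, -L_i), diag(L_i, L_i) and J_13, J_24 are diag(L_j, -L_j),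
diag(L_j, L_j); the cross terms of eta_12^2 and eta_34^2 cancel, as do those of
eta_13^2 and eta_24^2, and the remaining squares of the forms of L_i, L_j on H
are volume forms.  So the sum of four squares is 8 (vol_1 + vol_2), with vol_1
and vol_2 the volume forms of the two summands of H + H, and
Phi = OmegaR / 2 + 4 (vol_1 + vol_2).

Both equalities of 4-forms are obtained without expanding the forms in
coordinates of all four arguments.  When J is skew-adjoint, the value of
omega_J^2 at (x, y, z, w) is 2 <x, v> for a vector v = [cross J y z w]
([kahler_sqE]), so that it is enough to compare vectors that are trilinear in
y, z, w ([sum_cross_right_qmul], [sum_cross_cayley]).  For the Cayley form this
comparison yields
  y (conj(z) w) - <y, z> w - <z, w> y + <y, w> z,
which is y (conj(z) w) when y, z, w are orthogonal.  Finally an alternating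
4-form is determined by its values at arguments of which the last three are
orthogonal, by Gram-Schmidt ([alternating_eq0]). *)

(** * Squares of Kähler forms *)

Lemma dotC {R : realType} {n} (x y : 'cV[R]_n) : dot x y = dot y x.
Proof. by apply: eq_bigr => i _; rewrite mulrC. Qed.

Lemma dot_eq0 {R : realType} {n} (x : 'cV[R]_n) : (dot x x == 0) = (x == 0).
Proof.
apply/eqP/eqP => [xx0 | ->]; last first.
  by apply: big1 => i _; rewrite mxE mul0r.
have sq_ge0 (i : 'I_n) : true -> 0 <= x i 0 * x i 0 by rewrite -expr2 sqr_ge0.
apply/colP => i; rewrite mxE.
have /eqP : x i 0 * x i 0 = 0 by apply: (psumr_eq0P sq_ge0 xx0).
by rewrite mulf_eq0 orbb => /eqP.
Qed.

Definition skew {R : realType} {n} (J : 'cV[R]_n -> 'cV[R]_n) :=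
  forall x y, dot y (J x) = - dot x (J y).

(** For skew-adjoint J, the vector dual to half the contraction of omega_J^2
with y, z, w in its last three arguments. *)
Definition cross {R : realType} {n} (J : 'cV[R]_n -> 'cV[R]_n)
    (y z w : 'cV[R]_n) : 'cV[R]_n :=
  dot z (J w) *: J y - dot y (J w) *: J z + dot y (J z) *: J w.

Lemma kahler_sqE {R : realType} (J : 'cV[R]_8 -> 'cV[R]_8) (x y z w : 'cV[R]_8) :
  skew J ->
  wedge_sq (kahler J) [tuple x; y; z; w] = 2%:R * dot x (cross J y z w).
Proof.
move=> Jskew; rewrite wedge_sqE; last by move=> a b; exact: Jskew.
by rewrite /kahler /cross /= !(dotD, dotN, dotZ) /=; ring.
Qed.

Lemma kahler_sq_alternating {R : realType} (J : 'cV[R]_8 -> 'cV[R]_8) :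
  skew J -> linear J -> alternating_form (wedge_sq (kahler J)).
Proof.
move=> Jskew Jlin; apply: wedge_sq_alternating => [a b | c a b d].
  exact: Jskew.
by rewrite /kahler /= [tnth _ _]/= Jlin dotD dotZ.
Qed.

(** * The complex structures *)

(** The adjoint of a product of two anti-commuting self-adjoint maps is the
product in the other order, hence its opposite. *)
Lemma pauliJ_skew {R : realType} (a b : nat) :
  (1 <= a <= 5)%N -> (1 <= b <= 5)%N -> a != b -> skew (pauliJ R a b).
Proof.
move=> a5 b5 ab x y; rewrite /pauliJ -pauli_selfadjoint // -pauli_selfadjoint //.
by rewrite dotC pauli_anticommute 1?eq_sym // dotN.
Qed.

Lemma pauliJ_linear {R : realType} (a b : nat) : linear (pauliJ R a b).
Proof. by move=> c x y; rewrite /pauliJ !mulmxDr -!scalemxAr. Qed.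

Lemma right_qmulE {R : realType} (u h g : 'cV[R]_4) :
  right_qmul u (Hpair h g) = Hpair (qmul h u) (qmul g u).
Proof. by rewrite /right_qmul HfstE HsndE. Qed.

Lemma right_qmul_skew {R : realType} (b c d : R) :
  skew (right_qmul (quat 0 b c d)).
Proof.
move=> x y.
have [x0 [x1 [x2 [x3 [x4 [x5 [x6 [x7 ->]]]]]]]] := octP x.
have [y0 [y1 [y2 [y3 [y4 [y5 [y6 [y7 ->]]]]]]]] := octP y.
by rewrite !right_qmulE !qmulE !dot_Hpair !dot_quat; ring.
Qed.

Lemma right_qmul_linear {R : realType} (u : 'cV[R]_4) : linear (right_qmul u).
Proof.
move=> k x y; have [a [b [c [d ->]]]] := quatP u.
have [x0 [x1 [x2 [x3 [x4 [x5 [x6 [x7 ->]]]]]]]] := octP x.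
have [y0 [y1 [y2 [y3 [y4 [y5 [y6 [y7 ->]]]]]]]] := octP y.
rewrite !right_qmulE HpairZ !HpairD !right_qmulE !qmulE HpairZ HpairD.
rewrite !(quatZ, quatD) !qmulE.
by apply: eq_oct; ring.
Qed.

Lemma left_unitE {R : realType} (a b c d : R) :
  (qmul (quat_i R) (quat a b c d) = quat (- b) a (- d) c) *
  (qmul (quat_j R) (quat a b c d) = quat (- c) d a (- b)) *
  (qmul (quat_k R) (quat a b c d) = quat (- d) (- c) b a).
Proof. by rewrite !qmulE; do !split; congr quat; ring. Qed.

Lemma right_unitE {R : realType} (a b c d : R) :
  (qmul (quat a b c d) (quat_i R) = quat (- b) a d (- c)) *
  (qmul (quat a b c d) (quat_j R) = quat (- c) (- d) a b) *
  (qmul (quat a b c d) (quat_k R) = quat (- d) c (- b) a).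
Proof. by rewrite !qmulE; do !split; congr quat; ring. Qed.

Lemma pauliJE {R : realType} (a b c d e f g h : R) :
  let x := Hpair (quat a b c d) (quat e f g h) in
  (pauliJ R 1 2 x = Hpair (quat (- b) a (- d) c) (quat f (- e) h (- g))) *
  (pauliJ R 1 3 x = Hpair (quat (- c) d a (- b)) (quat g (- h) (- e) f)) *
  (pauliJ R 1 4 x = Hpair (quat (- d) (- c) b a) (quat h g (- f) (- e))) *
  (pauliJ R 2 3 x = Hpair (quat d c (- b) (- a)) (quat h g (- f) (- e))) *
  (pauliJ R 2 4 x = Hpair (quat (- c) d a (- b)) (quat (- g) h e (- f))) *
  (pauliJ R 3 4 x = Hpair (quat b (- a) d (- c)) (quat f (- e) h (- g))) *
  (pauliJ R 1 5 x = Hpair (quat (- e) (- f) (- g) (- h)) (quat a b c d)) *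
  (pauliJ R 2 5 x = Hpair (quat (- f) e (- h) g) (quat (- b) a (- d) c)) *
  (pauliJ R 3 5 x = Hpair (quat (- g) h e (- f)) (quat (- c) d a (- b))) *
  (pauliJ R 4 5 x = Hpair (quat (- h) (- g) f e) (quat (- d) (- c) b a)).
Proof. by rewrite /pauliJ /= !pauliE !(left_unitE, quatN) !opprK. Qed.

(** * Trilinear identities *)

Definition sum_cross_R {R : realType} (y z w : 'cV[R]_8) : 'cV[R]_8 :=
  cross (right_qmul (quat_i R)) y z w + cross (right_qmul (quat_j R)) y z w
  + cross (right_qmul (quat_k R)) y z w.

(** The dual form of the proportionality of the two Sp(2)Sp(1)-invariant
4-forms.  The coordinates of both sides are the same trilinear polynomials in
those of y, z, w. *)
Lemma sum_cross_right_qmul {R : realType} (y z w : 'cV[R]_8) :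
  sum_cross_R y z w =
  - 2%:R^-1 *:
   (cross (pauliJ R 1 2) y z w + cross (pauliJ R 1 3) y z w
    + cross (pauliJ R 2 4) y z w + cross (pauliJ R 3 4) y z w
    + cross (pauliJ R 2 3) y z w + cross (pauliJ R 1 4) y z w
    + cross (pauliJ R 1 5) y z w + cross (pauliJ R 2 5) y z w
    + cross (pauliJ R 3 5) y z w + cross (pauliJ R 4 5) y z w).
Proof.
rewrite /sum_cross_R /cross.
have [y0 [y1 [y2 [y3 [y4 [y5 [y6 [y7 ->]]]]]]]] := octP y.
have [z0 [z1 [z2 [z3 [z4 [z5 [z6 [z7 ->]]]]]]]] := octP z.
have [w0 [w1 [w2 [w3 [w4 [w5 [w6 [w7 ->]]]]]]]] := octP w.
rewrite !right_qmulE !right_unitE !pauliJE !dot_Hpair !dot_quat.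
rewrite !HpairZ !HpairN !HpairD HpairZ.
rewrite !quatZ !quatN !quatD !quatZ.
by apply: eq_oct; field.
Qed.

(** The first four terms are dual to 4 (vol_1 + vol_2), the correction that
turns OmegaR / 2 into the Cayley form. *)
Lemma sum_cross_cayley {R : realType} (y z w : 'cV[R]_8) :
  (cross (pauliJ R 1 2) y z w + cross (pauliJ R 1 3) y z w
   + cross (pauliJ R 2 4) y z w + cross (pauliJ R 3 4) y z w)
  + sum_cross_R y z w =
  omul y (omul (oconj z) w) - dot y z *: w - dot z w *: y + dot y w *: z.
Proof.
rewrite /sum_cross_R /cross.
have [y0 [y1 [y2 [y3 [y4 [y5 [y6 [y7 ->]]]]]]]] := octP y.
have [z0 [z1 [z2 [z3 [z4 [z5 [z6 [z7 ->]]]]]]]] := octP z.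
have [w0 [w1 [w2 [w3 [w4 [w5 [w6 [w7 ->]]]]]]]] := octP w.
rewrite !right_qmulE !right_unitE !pauliJE !dot_Hpair !dot_quat.
rewrite oconjE qconjE quatN !omulE !(qmulE, qconjE, quatN, quatD).
rewrite !HpairZ !HpairN !HpairD.
rewrite !quatZ !quatN !quatD.
by apply: eq_oct; ring.
Qed.

(** * Determination of a 4-form by its values on orthogonal arguments *)

Lemma alternatingB {R : realType} {V : lmodType R} {k} (f g : k.-tuple V -> R) :
  alternating_form f -> alternating_form g ->
  alternating_form (fun v => f v - g v).
Proof.
move=> [fm fa] [gm ga]; split=> [v i a x y | v i j ij E].
  by rewrite fm gm; ring.
by rewrite (fa v i j) // (ga v i j) // subr0.
Qed.

Lemma multilinear4D {R : realType} {V : lmodType R} {f : 4.-tuple V -> R}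
    (x y z w : V) (a : R) (p : V) : multilinear_form f ->
  f [tuple x; y; a *: p + z; w] =
    a * f [tuple x; y; p; w] + f [tuple x; y; z; w] /\
  f [tuple x; y; z; a *: p + w] =
    a * f [tuple x; y; z; p] + f [tuple x; y; z; w].
Proof.
move=> lin.
have upd i q : tupdate [tuple x; y; z; w] i q =
    [tuple if i == 0%N :> nat then q else x; if i == 1%N :> nat then q else y;
           if i == 2%N :> nat then q else z; if i == 3%N :> nat then q else w].
  apply: eq_from_tnth => j; rewrite tnth_mktuple !(tnth_nth x) /=.
  by case: i j => [[|[|[|[|?]]]] ?] // [[|[|[|[|?]]]] ?].
have at_ i := lin [tuple x; y; z; w] i a p.
split.
- by have := at_ (inord 2) z; rewrite !upd !inordK.
- by have := at_ (inord 3) w; rewrite !upd !inordK.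
Qed.

(** Gram-Schmidt without normalisation: subtracting from z a multiple of y, and
from w multiples of y and z, makes y, z, w orthogonal without changing the
value of an alternating form. *)
Lemma alternating_eq0 {R : realType} (f : 4.-tuple 'cV[R]_8 -> R) :
  alternating_form f ->
  (forall x y z w, dot y z = 0 -> dot y w = 0 -> dot z w = 0 ->
     f [tuple x; y; z; w] = 0) ->
  forall v, f v = 0.
Proof.
move=> [f_lin f_alt] f0 v; have [x [y [z [w ->]]]] := tuple4P v.
have f_eq (p q r s : 'cV[R]_8) :
    [\/ q = r, q = s | r = s] -> f [tuple p; q; r; s] = 0.
  case=> E; [apply: (f_alt _ (inord 1) (inord 2)) |
    apply: (f_alt _ (inord 1) (inord 3)) | apply: (f_alt _ (inord 2) (inord 3))];
    by rewrite ?(tnth_nth p) /= -?val_eqE /= ?inordK //= E.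
have f_z x' y' a z' w' :
    f [tuple x'; y'; a *: y' + z'; w'] = f [tuple x'; y'; z'; w'].
  have [-> _] := multilinear4D x' y' z' w' a y' f_lin.
  by rewrite f_eq ?mulr0 ?add0r //; constructor 1.
have f_w x' y' z' a b w' :
    f [tuple x'; y'; z'; a *: y' + (b *: z' + w')] = f [tuple x'; y'; z'; w'].
  have [_ ->] := multilinear4D x' y' z' (b *: z' + w') a y' f_lin.
  have [_ ->] := multilinear4D x' y' z' w' b z' f_lin.
  rewrite (f_eq x' y' z' y') ?(f_eq x' y' z' z') ?mulr0 ?add0r //.
    by constructor 3.
  by constructor 2.
(* for p = 0 the quotient is 0, and the orthogonality below still holds *)
pose proj (p q : 'cV[R]_8) := dot p q / dot p p.
have projP p q : dot p (q - proj p q *: p) = 0.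
  rewrite dotD dotN dotZ /proj.
  have [-> | p0] := eqVneq p 0.
    by rewrite /dot !big1 ?mulr0 ?subr0 // => i _; rewrite mxE mul0r.
  by rewrite divfK ?subrr ?dot_eq0.
pose z' := z - proj y z *: y.
have yz' : dot y z' = 0 by exact: projP.
pose w' := w - proj y w *: y - proj z' w *: z'.
have z'y : dot z' y = 0 by rewrite dotC.
have -> : z = proj y z *: y + z' by rewrite /z' addrC subrK.
rewrite f_z.
have -> : w = proj y w *: y + (proj z' w *: z' + w').
  by rewrite /w' [proj z' w *: _ + _]addrC subrK addrC subrK.
rewrite f_w; apply: f0 => //.
  by rewrite dotD projP dotN dotZ yz' mulr0 subr0.
by rewrite /w' addrAC dotD projP dotN dotZ z'y mulr0 subr0.
Qed.

Lemma cayley_calibration_unique {R : realType} {Phi Psi : 4.-tuple 'cV[R]_8 -> R} :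
  cayley_calibration Phi -> cayley_calibration Psi -> Phi =1 Psi.
Proof.
move=> [altPhi PhiE] [altPsi PsiE] v; apply/eqP; rewrite -subr_eq0; apply/eqP.
apply: (alternating_eq0 _ (alternatingB _ _ altPhi altPsi)) => x y z w yz yw zw.
by rewrite PhiE // PsiE // subrr.
Qed.

(** * The two 4-forms *)

Lemma OmegaR_cross {R : realType} (x y z w : 'cV[R]_8) :
  OmegaR R [tuple x; y; z; w] = 2%:R * dot x (sum_cross_R y z w).
Proof.
rewrite /OmegaR !kahler_sqE; try exact: right_qmul_skew.
by rewrite -!mulrDr -!dotD.
Qed.

Lemma OmegaR_etaE {R : realType} (v : 4.-tuple 'cV[R]_8) :
  OmegaR R v = - 2%:R^-1 *
    (eta_sq R 1 2 v + eta_sq R 1 3 v + eta_sq R 2 4 v + eta_sq R 3 4 v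
     + eta_sq R 2 3 v + eta_sq R 1 4 v + eta_sq R 1 5 v
     + eta_sq R 2 5 v + eta_sq R 3 5 v + eta_sq R 4 5 v).
Proof.
have [x [y [z [w ->]]]] := tuple4P v.
rewrite OmegaR_cross sum_cross_right_qmul /eta_sq /eta.
rewrite !kahler_sqE; try exact: pauliJ_skew.
by rewrite -!mulrDr -!dotD dotZ mulrCA.
Qed.

Lemma cayley_calibration_OmegaR {R : realType} :
  cayley_calibration (fun v : 4.-tuple 'cV[R]_8 => 2%:R^-1 *
    ((eta_sq R 1 2 v + eta_sq R 1 3 v + eta_sq R 2 4 v + eta_sq R 3 4 v)
     + OmegaR R v)).
Proof.
have eta_alt a b : (1 <= a <= 5)%N -> (1 <= b <= 5)%N -> a != b ->
    alternating_form (eta_sq R a b).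
  move=> a5 b5 ab; apply: kahler_sq_alternating; last exact: pauliJ_linear.
  exact: pauliJ_skew.
have right_alt b c d :
    alternating_form (wedge_sq (kahler (right_qmul (quat (0 : R) b c d)))).
  apply: kahler_sq_alternating; last exact: right_qmul_linear.
  exact: right_qmul_skew.
split=> [|x y z w yz yw zw].
  apply: alternatingZ; apply: alternatingD.
    by do 3 (apply: alternatingD; last exact: eta_alt); exact: eta_alt.
  by do 2 (apply: alternatingD; last exact: right_alt); exact: right_alt.
rewrite OmegaR_cross /eta_sq /eta.
rewrite !kahler_sqE; try exact: pauliJ_skew.
rewrite -!mulrDr -!dotD sum_cross_cayley yz yw zw !scale0r !subr0 addr0.
by rewrite mulKf // pnatr_eq0.
Qed.

Theorem theorem1p2 (R : realType) :
  (forall Phi : 4.-tuple 'cV[R]_8 -> R, cayley_calibration Phi ->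
    forall v : 4.-tuple 'cV[R]_8,
    Phi v = 4%:R^-1 *
      (eta_sq R 1 2 v + eta_sq R 1 3 v + eta_sq R 2 4 v + eta_sq R 3 4 v
       - eta_sq R 2 3 v - eta_sq R 1 4 v - eta_sq R 1 5 v
       - eta_sq R 2 5 v - eta_sq R 3 5 v - eta_sq R 4 5 v))
  /\
  (forall v : 4.-tuple 'cV[R]_8,
    OmegaR R v = - 2%:R^-1 *
      (eta_sq R 1 2 v + eta_sq R 1 3 v + eta_sq R 2 4 v + eta_sq R 3 4 v
       + eta_sq R 2 3 v + eta_sq R 1 4 v + eta_sq R 1 5 v
       + eta_sq R 2 5 v + eta_sq R 3 5 v + eta_sq R 4 5 v)).
Proof.
split=> [Phi cayPhi v | v]; last exact: OmegaR_etaE.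
rewrite (cayley_calibration_unique cayPhi cayley_calibration_OmegaR).
rewrite OmegaR_etaE.
move: (eta_sq R 1 2 v) (eta_sq R 1 3 v) (eta_sq R 2 4 v) (eta_sq R 3 4 v)
  (eta_sq R 2 3 v) (eta_sq R 1 4 v) (eta_sq R 1 5 v) (eta_sq R 2 5 v)
  (eta_sq R 3 5 v) (eta_sq R 4 5 v) => *.
by field.
Qed.
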